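(* Let $(A,p,0,\frac12,1)$ be a mobi algebra and define, for all $a,b\in A$, $\overline{a}=p(1,a,0)$, $a\cdot b=p(0,a,b)$ and $a\oplus b=p(a,\frac12,b)$. Then $(A,\overline{()},\oplus,\cdot,1)$ is an IMM algebra in which $\overline{1}=0$ and $\overline{1}\oplus 1=\frac12$.
   Context: A mobi algebra is a system $(A,p,0,\frac12,1)$, where $A$ is a set, $p:A^3\to A$ is a ternary operation and $0,\frac12,1$ are elements of $A$ ($\frac12$ is only a symbol for a distinguished element), such that for all elements of $A$: (A1) $p(1,\frac12,0)=\frac12$; (A2) $p(0,a,1)=a$; (A3) $p(a,b,a)=a$; (A4) $p(a,0,b)=a$; (A5) $p(a,1,b)=b$; (A6) $p(a,\frac12,b)=p(a',\frac12,b)\implies a=a'$; (A7) $p(a,p(c_1,c_2,c_3),b)=p(p(a,c_1,b),c_2,p(a,c_3,b))$; (A8) $p(p(a_1,c,b_1),\frac12,p(a_2,c,b_2))=p(p(a_1,\frac12,a_2),c,p(b_1,\frac12,b_2))$. An IMM algebra (involutive medial monoid) is a system $(B,\overline{()},\oplus,\cdot,1)$, where $B$ is a set, $\overline{()}$ is a unary operation, $\oplus$ and $\cdot$ are binary operations on $B$ and $1\in B$, such that for all elements of $B$: (B1) $a\oplus a=a$; (B2) $a\oplus b=b\oplus a$; (B3) $(a\oplus b)\oplus(c\oplus d)=(a\oplus c)\oplus(b\oplus d)$; (B4) $a\cdot(b\cdot c)=(a\cdot b)\cdot c$; (B5) $a\cdot 1=a=1\cdot a$; (B6) $a\cdot(b\oplus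 c)=(a\cdot b)\oplus(a\cdot c)$ and $(a\oplus b)\cdot c=(a\cdot c)\oplus(b\cdot c)$; (B7) $\overline{\overline{a}}=a$; (B8) $\overline{a\oplus b}=\overline{a}\oplus\overline{b}$; (B9) $a\cdot\overline{1}=\overline{1}=\overline{1}\cdot a$; (B10) $\overline{a}\oplus a=\overline{1}\oplus 1$. *)

(* Defs.v *)
Set Implicit Arguments.
Unset Strict Implicit.
Unset Printing Implicit Defensive.

Record is_mobi_algebra (A : Type) (p : A -> A -> A -> A) (zero half one : A)
    : Prop := IsMobiAlgebra {
  mobi_A1 : p one half zero = half;
  mobi_A2 : forall a, p zero a one = a;
  mobi_A3 : forall a b, p a b a = a;
  mobi_A4 : forall a b, p a zero b = a;
  mobi_A5 : forall a b, p a one b = b;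
  mobi_A6 : forall a a' b, p a half b = p a' half b -> a = a';
  mobi_A7 : forall a b c1 c2 c3,
    p a (p c1 c2 c3) b = p (p a c1 b) c2 (p a c3 b);
  mobi_A8 : forall a1 a2 b1 b2 c,
    p (p a1 c b1) half (p a2 c b2) = p (p a1 half a2) c (p b1 half b2)
}.

(* Involutive medial monoid. *)
Record is_IMM_algebra (B : Type) (bar : B -> B) (oplus mul : B -> B -> B)
    (one : B) : Prop := IsIMMAlgebra {
  imm_B1 : forall a, oplus a a = a;
  imm_B2 : forall a b, oplus a b = oplus b a;
  imm_B3 : forall a b c d,
    oplus (oplus a b) (oplus c d) = oplus (oplus a c) (oplus b d);
  imm_B4 : forall a b c, mul a (mul b c) = mul (mul a b) c;
  imm_B5 : forall a, mul a one = a /\ a = mul one a;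
  imm_B6 : forall a b c,
    mul a (oplus b c) = oplus (mul a b) (mul a c) /\
    mul (oplus a b) c = oplus (mul a c) (mul b c);
  imm_B7 : forall a, bar (bar a) = a;
  imm_B8 : forall a b, bar (oplus a b) = oplus (bar a) (bar b);
  imm_B9 : forall a, mul a (bar one) = bar one /\ bar one = mul (bar one) a;
  imm_B10 : forall a, oplus (bar a) a = oplus (bar one) one
}.

Definition mobi_bar (A : Type) (p : A -> A -> A -> A) (zero one : A)
  (a : A) : A := p one a zero.

Definition mobi_mul (A : Type) (p : A -> A -> A -> A) (zero : A)
  (a b : A) : A := p zero a b.

Definition mobi_oplus (A : Type) (p : A -> A -> A -> A) (half : A)
  (a b : A) : A := p a half b.

(* Main.v *)
Require Import Defs.

(** The nontrivial axioms are instances of A7 and A8 at the constants. A7, distributivity in the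
    middle argument, gives associativity, involution and right distributivity; A8 gives mediality,
    left distributivity and B10. *)

Lemma mobi_half_comm (A : Type) (p : A -> A -> A -> A) (zero half one : A)
    (mobiA : is_mobi_algebra p zero half one) (a b : A) :
  p a half b = p b half a.
Proof.
  destruct mobiA as [A1 _ _ A4 A5 _ A7 _].
  (* By A1 [half] is its own complement, and by A7 complementing the middle argument swaps the
     endpoints. *)
  transitivity (p b (p one half zero) a).
  - now rewrite A7, A4, A5.
  - now rewrite A1.
Qed.

Theorem proposition4p1 (A : Type) (p : A -> A -> A -> A) (zero half one : A)
    (mobiA : is_mobi_algebra p zero half one) :
  is_IMM_algebra (mobi_bar p zero one) (mobi_oplus p half) (mobi_mul p zero) one
  /\ mobi_bar p zero one one = zero
  /\ mobi_oplus p half (mobi_bar p zero one one) one = half.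
Proof.
  pose proof (mobi_half_comm _ _ _ _ _ mobiA) as comm.
  destruct mobiA as [A1 A2 A3 A4 A5 _ A7 A8].
  unfold mobi_bar, mobi_oplus, mobi_mul.
  split; [constructor | split].
  - intros a. apply A3.
  - exact comm.
  - intros a b c d. apply A8.
  - intros a b c. now rewrite A7, A4.
  - intros a. now rewrite A2, A5.
  - intros a b c. split.
    (* A8 is read from right to left in effect: the endpoint [zero] is [p zero half zero] by A3. *)
    + now rewrite A8, A3.
    + apply A7.
  (* A7 turns the double complement into [p zero a one]. *)
  - intros a. now rewrite A7, A5, A4, A2.
  - intros a b. apply A7.
  - intros a. now rewrite A5, A3, A4.
  - intros a.
    rewrite A5, A2.
    (* Writing [a] as [p zero a one] makes the medial law (A8) applicable. *)
    transitivity (p (p one a zero) half (p zero a one)).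
    + now rewrite A2.
    + now rewrite A8, A1, A2, A3.
  - apply A5.
  - now rewrite A5, A2.
Qed.
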